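(* For the decorated hypercubic lattice model described in the context (any $d\ge1$), in the subspace with electron number $N_{\rm e}=L^d$ the ground states of $H$ all have total spin $S_{\rm tot}=N_{\rm e}/2$, and the ground state space has dimension exactly $2S_{\rm tot}+1=N_{\rm e}+1$ (i.e. the ground state is unique apart from the $(2S_{\rm tot}+1)$-fold spin degeneracy).
   Context: Let $d\ge1$ and let $L\ge4$ be an even integer. Let $V=(\mathbb Z/L\mathbb Z)^d$ be the $d$-dimensional $L\times\cdots\times L$ hypercubic lattice with periodic boundary conditions, and let $B$ be the set of nearest-neighbour bonds $\{v,w\}$ ($v,w\in V$ at (periodic) Euclidean distance $1$). For each bond $\{v,w\}\in B$ introduce a new site $m(v,w)$ (the midpoint of the bond); let $M$ be the set of these midpoints and $\Lambda=V\cup M$. With fermion operators $c_{x\sigma}$, $x\in\Lambda$, $\sigma\in\{\uparrow,\downarrow\}$, satisfying the canonical anticommutation relations, vacuum $\Phi_0$, $n_{x\sigma}=c^\dagger_{x\sigma}c_{x\sigma}$ and electron number operator $\hat N_{\rm e}=\sum_x(n_{x\uparrow}+n_{x\downarrow})$, the Hamiltonian is $H=H_{\rm hop}+H_{\rm int}$ with $$H_{\rm hop}=\sum_{\sigma}\sum_{\{v,w\}\in B}t\,(c^\dagger_{v\sigma}+c^\dagger_{w\sigma}+\lambda c^\dagger_{m(v,w)\sigma})(c_{v\sigma}+c_{w\sigma}+\lambda c_{m(v,w)\sigma}),$$ $$H_{\rm int}=U\sum_{u\in V}n_{u\uparrow}n_{u\downarrow}+U'\sum_{x\in M}n_{x\uparrow}n_{x\downarrow},$$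 where $t>0$, $\lambda>0$, $U>0$, $U'>0$. Spin operators: $S^{(\alpha)}_x=\frac12\sum_{\sigma,\tau}c^\dagger_{x\sigma}p^{(\alpha)}_{\sigma\tau}c_{x\tau}$ with $p^{(1)},p^{(2)},p^{(3)}$ the Pauli matrices; $S^{(\alpha)}_{\rm tot}=\sum_{x\in\Lambda}S^{(\alpha)}_x$ and $({\bf S}_{\rm tot})^2=\sum_{\alpha=1}^3(S^{(\alpha)}_{\rm tot})^2$, whose eigenvalues are written $S_{\rm tot}(S_{\rm tot}+1)$. *)

(* Defs.v *)
From HB Require Import structures.
From mathcomp Require Import all_boot all_order all_algebra.
From mathcomp Require Export reals complex.
Set Implicit Arguments.
Unset Strict Implicit.
Unset Printing Implicit Defensive.
Import Order.TTheory GRing.Theory Num.Theory.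
Local Open Scope ring_scope.

Section Model.
Variables (R : realType) (d L : nat).

Local Notation C := (R[i]).
Definition rC (x : R) : C := Complex x 0.
Definition imagI : C := Complex 0 1.

Definition Vtx := {ffun 'I_d -> 'I_L}.

(** v and w are at periodic Euclidean distance 1: they differ in exactly one
    coordinate i, and there by +1 or -1 modulo L. *)
Definition adjacent (v w : Vtx) : bool :=
  [exists i : 'I_d,
     [forall j : 'I_d, (j != i) ==> (v j == w j)] &&
     ((((v i).+1 %% L)%N == w i) || (((w i).+1 %% L)%N == v i))].

Definition isbond (b : {set Vtx}) : bool :=
  [exists v : Vtx, exists w : Vtx, adjacent v w && (b == [set v; w])].
Definition Bond := {b : {set Vtx} | isbond b}.

(** Sites Lambda = V + M, the midpoint m(b) of bond b being [inr b]. *)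
Definition Site := (Vtx + Bond)%type.
Definition vsite (u : Vtx) : Site := inl u.
Definition msite (b : Bond) : Site := inr b.

(** Spin index: [true] = up, [false] = down. A mode is (site, spin). *)
Definition Mode := (Site * bool)%type.

(** Fermionic Fock space: complex functions on occupation configurations
    (subsets of modes); the basis vector of S is the product of creation
    operators of the modes of S (in the order of [enum_rank]) applied to the
    vacuum (the indicator of set0). *)
Definition State := {ffun {set Mode} -> C^o}.

Definition vacuum : State := [ffun S : {set Mode} => if S == set0 then 1 else 0].

Definition jwsign (S : {set Mode}) (m : Mode) : C :=
  (-1) ^+ #|[set m' in S | (enum_rank m' < enum_rank m)%N]|.

Definition ann (m : Mode) (psi : State) : State :=
  [ffun S : {set Mode} => if m \in S then 0 else jwsign S m * psi (m |: S)].
Definition cre (m : Mode) (psi : State) : State :=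
  [ffun S : {set Mode} => if m \in S then jwsign S m * psi (S :\ m) else 0].

Definition numop (m : Mode) (psi : State) : State := cre m (ann m psi).

Definition Nop (psi : State) : State :=
  \sum_(x : Site) (numop (x, true) psi + numop (x, false) psi).

Definition Aann (lam : R) (b : Bond) (s : bool) (psi : State) : State :=
  \sum_(x in val b) ann (vsite x, s) psi + rC lam *: ann (msite b, s) psi.
Definition Acre (lam : R) (b : Bond) (s : bool) (psi : State) : State :=
  \sum_(x in val b) cre (vsite x, s) psi + rC lam *: cre (msite b, s) psi.

Definition Hhop (t lam : R) (psi : State) : State :=
  \sum_(s : bool) \sum_(b : Bond) rC t *: Acre lam b s (Aann lam b s psi).

Definition Hint (U U' : R) (psi : State) : State :=
  rC U *: (\sum_(u : Vtx) numop (vsite u, true) (numop (vsite u, false) psi))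
  + rC U' *: (\sum_(b : Bond) numop (msite b, true) (numop (msite b, false) psi)).

Definition Ham (t lam U U' : R) (psi : State) : State :=
  Hhop t lam psi + Hint U U' psi.

(** Pauli matrices p^(1), p^(2), p^(3) (indexed by 'I_3 = {0,1,2}),
    basis order (up, down). *)
Definition pauli (a : 'I_3) (s s' : bool) : C :=
  match val a with
  | 0 => if s == s' then 0 else 1
  | 1 => if s == s' then 0 else if s then - imagI else imagI
  | _ => if s == s' then (if s then 1 else -1) else 0
  end.

Definition Spin (x : Site) (a : 'I_3) (psi : State) : State :=
  (2%:R)^-1 *: \sum_(s : bool) \sum_(s' : bool)
      pauli a s s' *: cre (x, s) (ann (x, s') psi).

Definition Stot (a : 'I_3) (psi : State) : State :=
  \sum_(x : Site) Spin x a psi.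

Definition Stot2 (psi : State) : State :=
  \sum_(a : 'I_3) Stot a (Stot a psi).

Definition in_sector (N : nat) (psi : State) : Prop :=
  Nop psi = N%:R *: psi.

Definition is_ground_energy (H : State -> State) (N : nat) (E0 : C) : Prop :=
  (exists psi : State, psi != 0 /\ in_sector N psi /\ H psi = E0 *: psi) /\
  (forall (E : C) (psi : State),
      psi != 0 -> in_sector N psi -> H psi = E *: psi -> E0 <= E).

Definition in_ground_space (H : State -> State) (N : nat) (E0 : C)
    (psi : State) : Prop :=
  in_sector N psi /\ H psi = E0 *: psi.

End Model.

(* Main.v *)
(* H is a sum of nonnegative terms, so energy 0 is minimal and the zero-energy
   states are exactly those killed by all bond operators
   A_b = sum_{x in b} c_x + lam c_{m(b)} and by all c_{x,up} c_{x,down}.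
   A_b psi = 0 trades c_{m(b)} for the operators on the ends of b, so psi is
   determined by its amplitudes on configurations of V.  With |V| electrons and
   no double occupancy these are spin configurations on V, and the absence of
   double occupancy at m(b) relates the amplitudes of two configurations that
   differ by exchanging the spins at the ends of b.  As the lattice is
   connected, one amplitude for each number of down spins determines psi, so
   the dimension is at most |V| + 1.
   Conversely the operators c*_u - lam^-1 sum_{b ni u} c*_{m(b)} anticommute
   with every A_b; filling all of them with spin up gives a zero-energy state,
   and its images under the powers of the lowering operator S^-, which are
   nonzero by the sl2 relations, give |V| + 1 states of spin |V| / 2. *)
Require Import Defs.
From HB Require Import structures.
From mathcomp Require Import all_boot all_order all_algebra.
From mathcomp Require Import reals complex ring.
Set Implicit Arguments.
Unset Strict Implicit.
Unset Printing Implicit Defensive.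
Import Order.TTheory GRing.Theory Num.Theory.
Local Open Scope ring_scope.

Section FlatBand.
Variables (R : realType) (d L : nat).
Local Notation C := (R[i]).
Local Notation State := (State R d L).
Local Notation Mode := (Mode d L).
Local Notation Site := (Site d L).
Local Notation Vtx := (Vtx d L).
Local Notation Bond := (Bond d L).
Implicit Types (m : Mode) (S : {set Mode}) (psi phi : State).

(** * Fock space and canonical anticommutation relations *)

Lemma ann_linear m : linear (@ann R d L m).
Proof.
move=> a u v; apply/ffunP => S; rewrite !ffunE; case: ifP => _.
  by rewrite scaler0 addr0.
by rewrite mulrDr; congr (_ + _); rewrite /GRing.scale /= mulrCA.
Qed.
HB.instance Definition _ m :=
  GRing.isLinear.Build C State State *:%R (@ann R d L m) (@ann_linear m).

Lemma cre_linear m : linear (@cre R d L m).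
Proof.
move=> a u v; apply/ffunP => S; rewrite !ffunE; case: ifP => _; last first.
  by rewrite scaler0 addr0.
by rewrite mulrDr; congr (_ + _); rewrite /GRing.scale /= mulrCA.
Qed.
HB.instance Definition _ m :=
  GRing.isLinear.Build C State State *:%R (@cre R d L m) (@cre_linear m).

(* The sign acquired by moving mode m past mode m' in the fixed order of modes. *)
Definition order_sign m' m : C := (-1) ^+ (enum_rank m' < enum_rank m)%N.

Lemma order_sign_sqr m' m : order_sign m' m * order_sign m' m = 1.
Proof. by rewrite /order_sign -expr2 sqrr_sign. Qed.

(** Of two distinct modes exactly one precedes the other; this sign is the source of every
    anticommutation below. *)
Lemma order_sign_swap m m' : m != m' -> order_sign m m' = - order_sign m' m.
Proof.
move=> ne; rewrite /order_sign; case: ltngtP; rewrite ?expr1 ?expr0 ?opprK // => /eqP.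
by rewrite (inj_eq val_inj) (inj_eq enum_rank_inj) (negPf ne).
Qed.

Lemma jwsign_setU1 S m m' : m' \notin S ->
  jwsign R (m' |: S) m = order_sign m' m * jwsign R S m.
Proof.
move=> nS; rewrite /jwsign /order_sign -exprD; congr (_ ^+ _).
rewrite (cardsD1 m') !inE eqxx /=; congr (_ + _)%N.
apply: eq_card => x; rewrite !inE; case: eqVneq => //= ->.
by rewrite (negPf nS).
Qed.

Lemma jwsign_setD1 S m m' : m' \in S ->
  jwsign R (S :\ m') m = order_sign m' m * jwsign R S m.
Proof.
move=> iS; have := @jwsign_setU1 (S :\ m') m m'; rewrite setD1K // => -> //.
  by rewrite mulrA order_sign_sqr mul1r.
by rewrite !inE eqxx.
Qed.

Lemma order_sign_refl m : order_sign m m = 1.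
Proof. by rewrite /order_sign ltnn. Qed.

Lemma jwsign_sqr S m : jwsign R S m * jwsign R S m = 1.
Proof. by rewrite /jwsign -expr2 sqrr_sign. Qed.

Lemma jwsign_neq0 S m : jwsign R S m != 0.
Proof. by rewrite signr_eq0. Qed.

Lemma ann_ann m m' psi : ann m (ann m' psi) = - ann m' (ann m psi).
Proof.
apply/ffunP => S; rewrite !ffunE !inE.
case: (eqVneq m m') => [->|ne] /=; first by rewrite mulr0 if_same oppr0.
have [mS|mS] := boolP (m \in S).
  by rewrite /= mulr0 if_same oppr0.
have [m'S|m'S] /= := boolP (m' \in S); first by rewrite ?orbT ?mulr0 ?oppr0.
rewrite ?orbF !jwsign_setU1 //.
rewrite (order_sign_swap ne) setUCA.
by ring.
Qed.

Lemma ann_sqr m psi : ann m (ann m psi) = 0.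
Proof. by apply/ffunP => S; rewrite !ffunE !inE eqxx mulr0 if_same. Qed.

Lemma cre_cre m m' psi : cre m (cre m' psi) = - cre m' (cre m psi).
Proof.
apply/ffunP => S; rewrite !ffunE !inE.
case: (eqVneq m m') => [->|ne] /=; first by rewrite mulr0 if_same oppr0.
have [mS|mS] := boolP (m \in S); last by rewrite /= mulr0 if_same oppr0.
have [m'S|m'S] /= := boolP (m' \in S); last by rewrite mulr0 oppr0.
rewrite !jwsign_setD1 // (order_sign_swap ne) !setDDl [[set m] :|: _]setUC.
by ring.
Qed.

(** For equal modes exactly one of the two products survives on a given configuration, and its sign
    squares to 1. For distinct modes the two orders differ by [order_sign_swap]. *)
Lemma ann_cre m m' psi :
  ann m (cre m' psi) = (if m == m' then psi else 0) - cre m' (ann m psi).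
Proof.
apply/ffunP => S; rewrite !ffunE !inE.
case: (eqVneq m m') => [->|ne] /=.
  have [mS|mS] := boolP (m' \in S).
    by rewrite setD1K // jwsign_setD1 // order_sign_refl mul1r mulrA jwsign_sqr mul1r subrr.
  by rewrite setU1K // jwsign_setU1 // order_sign_refl mul1r mulrA jwsign_sqr mul1r subr0.
rewrite ffunE add0r.
have [mS|mS] /= := boolP (m \in S); first by rewrite mulr0 if_same oppr0.
have [m'S|m'S] /= := boolP (m' \in S); last by rewrite mulr0 oppr0.
rewrite jwsign_setU1 // jwsign_setD1 // (order_sign_swap ne).
have -> : (m |: S) :\ m' = m |: S :\ m'.
  apply/setP => x; rewrite !inE.
  by case: (eqVneq x m) => [->|_] /=; rewrite ?orbF ?andbT ?ne.
by ring.
Qed.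

Lemma numopE m psi S : numop m psi S = if m \in S then psi S else 0.
Proof.
rewrite /numop !ffunE !inE eqxx /=; case: ifP => // mS.
by rewrite jwsign_setD1 // order_sign_refl mul1r mulrA jwsign_sqr mul1r setD1K.
Qed.

(** * Inner product and adjoints *)

Definition dot phi psi : C := \sum_S (phi S)^* * psi S.

Lemma dotDr phi u v : dot phi (u + v) = dot phi u + dot phi v.
Proof. by rewrite /dot -big_split; apply: eq_bigr => S _; rewrite ffunE mulrDr. Qed.

Lemma dotZr phi a u : dot phi (a *: u) = a * dot phi u.
Proof.
by rewrite /dot mulr_sumr; apply: eq_bigr => S _; rewrite ffunE mulrCA.
Qed.

Lemma dot_sumr phi (I : finType) (P : pred I) (F : I -> State) :
  dot phi (\sum_(i | P i) F i) = \sum_(i | P i) dot phi (F i).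
Proof.
apply: (big_morph (dot phi)) => [u v|]; first exact: dotDr.
by rewrite -(scale0r (0 : State)) dotZr mul0r.
Qed.

Lemma dotC phi psi : (dot phi psi)^* = dot psi phi.
Proof.
rewrite /dot rmorph_sum /=; apply: eq_bigr => S _.
by rewrite rmorphM /= conjCK mulrC.
Qed.

Lemma dotDl phi u v : dot (u + v) phi = dot u phi + dot v phi.
Proof. by rewrite -dotC dotDr rmorphD /= !dotC. Qed.

Lemma dotZl phi a u : dot (a *: u) phi = a^* * dot u phi.
Proof. by rewrite -dotC dotZr rmorphM /= dotC. Qed.

Lemma dot_suml phi (I : finType) (P : pred I) (F : I -> State) :
  dot (\sum_(i | P i) F i) phi = \sum_(i | P i) dot (F i) phi.
Proof.
by rewrite -dotC dot_sumr rmorph_sum /=; apply: eq_bigr => i _; rewrite dotC.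
Qed.

Lemma dot_ge0 psi : 0 <= dot psi psi.
Proof. by apply: sumr_ge0 => S _; rewrite mulrC mul_conjC_ge0. Qed.

Lemma dot_eq0 psi : (dot psi psi == 0) = (psi == 0).
Proof.
apply/idP/eqP => [|->]; last by rewrite -{2}(scale0r (0 : State)) dotZr mul0r.
rewrite psumr_eq0 => [/allP h|S _]; last by rewrite mulrC mul_conjC_ge0.
apply/ffunP => S; rewrite ffunE; apply/eqP.
by rewrite -mul_conjC_eq0 mulrC; apply: h; rewrite mem_index_enum.
Qed.

Lemma conj_jwsign S m : (jwsign R S m)^* = jwsign R S m.
Proof. by rewrite /jwsign rmorphXn rmorphN rmorph1. Qed.

(** The map from [S] to [m |: S] is a bijection from configurations without [m] onto those with [m],
    and the sign is real. *)
Lemma dot_cre m phi psi : dot phi (cre m psi) = dot (ann m phi) psi.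
Proof.
rewrite /dot.
transitivity (\sum_(S : {set Mode} | m \in S) (phi S)^* * (jwsign R S m * psi (S :\ m))).
  rewrite [RHS]big_mkcond /=; apply: eq_bigr => S _; rewrite ffunE.
  by case: ifP; rewrite ?mulr0.
transitivity (\sum_(S : {set Mode} | m \notin S) (jwsign R S m * phi (m |: S))^* * psi S);
  last first.
  rewrite [LHS]big_mkcond /=; apply: eq_bigr => S _; rewrite ffunE.
  by case: (m \in S) => /=; rewrite ?rmorph0 ?mul0r.
rewrite (reindex_onto (fun S : {set Mode} => m |: S) (fun S => S :\ m)) /=; last first.
  by move=> S mS; rewrite setD1K.
apply: eq_big => [S|S /andP[_ /eqP h]].
  rewrite !inE eqxx /=; apply/eqP/idP => [<-|]; first by rewrite !inE eqxx.
  exact: setU1K.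
have mS : m \notin S by rewrite -h !inE eqxx.
rewrite h jwsign_setU1 // order_sign_refl mul1r rmorphM /= conj_jwsign.
by rewrite mulrA [_ * jwsign _ _ _]mulrC.
Qed.

Lemma conj_rC (x : R) : (rC x)^* = rC x.
Proof. by apply: conj_Creal; rewrite realE !lecE /= eqxx le_total. Qed.

Lemma rC_ge0 (x : R) : (0 <= rC x) = (0 <= x).
Proof. by rewrite lecE /= eqxx. Qed.

Lemma rC_neq0 (x : R) : 0 < x -> rC x != 0.
Proof. by move=> x0; rewrite eq_complex /= negb_and (gt_eqF x0). Qed.

(** * The Hamiltonian as a sum of squares *)

Lemma dot_Acre lam (b : Bond) s phi psi :
  dot phi (Acre lam b s psi) = dot (Aann lam b s phi) psi.
Proof.
rewrite /Acre /Aann dotDr dotDl dot_sumr dot_suml dotZr dotZl conj_rC dot_cre.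
by congr (_ + _); apply: eq_bigr => x _; rewrite dot_cre.
Qed.

(** Normal ordering brings the on-site repulsion to the form X^* X, where X is a product of two
    annihilators. *)
Lemma numop_numop m m' psi : m != m' ->
  numop m (numop m' psi) = cre m' (cre m (ann m (ann m' psi))).
Proof.
move=> ne; rewrite /numop ann_cre (negPf ne) sub0r linearN /= cre_cre opprK.
by [].
Qed.

Lemma dot_numop_numop m m' psi : m != m' ->
  dot psi (numop m (numop m' psi)) = dot (ann m (ann m' psi)) (ann m (ann m' psi)).
Proof. by move=> ne; rewrite numop_numop // !dot_cre. Qed.

Lemma Aann_linear lam b s : linear (@Aann R d L lam b s).
Proof.
move=> a u v; rewrite /Aann linearP /=.
under eq_bigr do rewrite linearP /=.
by rewrite big_split /= -scaler_sumr !scalerDr addrACA !scalerA [rC lam * a]mulrC.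
Qed.
HB.instance Definition _ lam b s :=
  GRing.isLinear.Build C State State *:%R (@Aann R d L lam b s)
    (@Aann_linear lam b s).

Lemma up_neq_dn (x : Site) : (x, true) != (x, false).
Proof. by rewrite xpair_eqE andbF. Qed.

Definition unfrustrated lam psi : Prop :=
  (forall b s, Aann lam b s psi = 0) /\
  (forall x : Site, ann (x, true) (ann (x, false) psi) = 0).

Definition energy t lam U U' psi : C :=
  \sum_(s : bool) \sum_(b : Bond)
     rC t * dot (Aann lam b s psi) (Aann lam b s psi)
  + (rC U * (\sum_(u : Vtx)
       dot (ann (vsite u, true) (ann (vsite u, false) psi))
           (ann (vsite u, true) (ann (vsite u, false) psi)))
  + rC U' * (\sum_(b : Bond)
       dot (ann (msite b, true) (ann (msite b, false) psi))
           (ann (msite b, true) (ann (msite b, false) psi)))).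

Lemma dot_Ham t lam U U' psi :
  dot psi (Ham t lam U U' psi) = energy t lam U U' psi.
Proof.
rewrite /Ham /Hhop /Hint /energy !dotDr !dotZr !dot_sumr; congr (_ + (_ * _ + _ * _)).
- apply: eq_bigr => s _; rewrite dot_sumr; apply: eq_bigr => b _.
  by rewrite dotZr dot_Acre.
- by apply: eq_bigr => u _; rewrite dot_numop_numop ?up_neq_dn.
- by apply: eq_bigr => u _; rewrite dot_numop_numop ?up_neq_dn.
Qed.

Section Positive.
Variables (t lam U U' : R).
Hypotheses (t0 : 0 < t) (U0 : 0 < U) (U'0 : 0 < U').

Lemma energy_ge0 psi : 0 <= energy t lam U U' psi.
Proof.
apply: addr_ge0.
  apply: sumr_ge0 => s _; apply: sumr_ge0 => b _.
  by rewrite mulr_ge0 ?rC_ge0 ?dot_ge0 // ltW.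
by apply: addr_ge0; apply: mulr_ge0; rewrite ?rC_ge0; try exact: ltW;
  apply: sumr_ge0 => x _; apply: dot_ge0.
Qed.

(** A vanishing sum of nonnegative numbers vanishes term by term, and the strictly positive
    couplings can be cancelled. *)
Lemma energy_eq0 psi : energy t lam U U' psi = 0 -> unfrustrated lam psi.
Proof.
move=> /eqP; rewrite /energy.
set h := \sum_(s : bool) _; set v := \sum_(u : Vtx) _; set w := \sum_(b : Bond) _.
have h0 : 0 <= h.
  apply: sumr_ge0 => s _; apply: sumr_ge0 => b _.
  by rewrite mulr_ge0 ?rC_ge0 ?dot_ge0 // ltW.
have v0 : 0 <= v by apply: sumr_ge0 => *; apply: dot_ge0.
have w0 : 0 <= w by apply: sumr_ge0 => *; apply: dot_ge0.
have Uv0 : 0 <= rC U * v by rewrite mulr_ge0 // rC_ge0 ltW.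
have Uw0 : 0 <= rC U' * w by rewrite mulr_ge0 // rC_ge0 ltW.
rewrite paddr_eq0 ?addr_ge0 // => /andP[/eqP hE].
rewrite paddr_eq0 // !mulf_eq0 !(negPf (rC_neq0 _)) //= => /andP[/eqP vE /eqP wE].
split=> [b s|[u|b]].
- apply/eqP; rewrite -dot_eq0; apply/eqP.
  have hs : forall s', true ->
      0 <= \sum_b rC t * dot (Aann lam b s' psi) (Aann lam b s' psi).
    move=> s' _; apply: sumr_ge0 => b' _.
    by rewrite mulr_ge0 ?rC_ge0 ?dot_ge0 // ltW.
  have hb : forall b', true -> 0 <= rC t * dot (Aann lam b' s psi) (Aann lam b' s psi).
    by move=> b' _; rewrite mulr_ge0 ?rC_ge0 ?dot_ge0 // ltW.
  have := psumr_eq0P hs hE (i := s) isT; move/(psumr_eq0P hb)/(_ b isT)/eqP.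
  by rewrite mulf_eq0 (negPf (rC_neq0 t0)) => /eqP.
- apply/eqP; rewrite -dot_eq0; apply/eqP.
  by apply: (psumr_eq0P _ vE) => // *; apply: dot_ge0.
- apply/eqP; rewrite -dot_eq0; apply/eqP.
  by apply: (psumr_eq0P _ wE) => // *; apply: dot_ge0.
Qed.

Lemma Ham_eigenvalue_ge0 (E : C) psi :
  psi != 0 -> Ham t lam U U' psi = E *: psi -> 0 <= E.
Proof.
move=> psi0 HE; have := energy_ge0 psi; rewrite -dot_Ham HE dotZr.
by rewrite pmulr_lge0 // lt_neqAle dot_ge0 eq_sym dot_eq0 psi0.
Qed.

Lemma Ham_eq0 psi : Ham t lam U U' psi = 0 <-> unfrustrated lam psi.
Proof.
split=> [H0|[hA hD]].
  by apply: energy_eq0; rewrite -dot_Ham H0 -(scale0r (0 : State)) dotZr mul0r.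
rewrite /Ham /Hhop /Hint.
rewrite big1 => [|s _]; last first.
  rewrite big1 // => b _; rewrite hA /Acre !big1 => [|x _]; last by rewrite linear0.
  by rewrite linear0 !scaler0 addr0 scaler0.
have hn x : numop (x, true) (numop (x, false) psi) = 0.
  by rewrite numop_numop ?up_neq_dn // hD !linear0.
rewrite add0r [\sum_(u : Vtx) _]big1 => [|u _]; last exact: hn.
by rewrite big1 => [|b _]; [rewrite !scaler0 addr0 | exact: hn].
Qed.

End Positive.

Lemma unfrustrated_comb lam (I : finType) (c : I -> C) (F : I -> State) :
  (forall i, unfrustrated lam (F i)) -> unfrustrated lam (\sum_i c i *: F i).
Proof.
move=> hF; split=> [b s|x].
  by rewrite linear_sum big1 // => i _; rewrite linearZ /= (hF i).1 scaler0.
by rewrite !linear_sum big1 // => i _; rewrite !linearZ /= (hF i).2 scaler0.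
Qed.

(** * Spin ladder operators and sl2 relations *)

Definition Sminus psi : State := \sum_(x : Site) cre (x, false) (ann (x, true) psi).
Definition Splus psi : State := \sum_(x : Site) cre (x, true) (ann (x, false) psi).
(* [polarization] is twice the third component of the total spin. *)
Definition polarization psi : State :=
  \sum_(x : Site) (numop (x, true) psi - numop (x, false) psi).

Lemma Sminus_linear : linear Sminus.
Proof.
move=> a u v; rewrite /Sminus scaler_sumr -big_split.
by apply: eq_bigr => x _; rewrite /= !linearP.
Qed.
HB.instance Definition _ :=
  GRing.isLinear.Build C State State *:%R Sminus Sminus_linear.

Lemma Splus_linear : linear Splus.
Proof.
move=> a u v; rewrite /Splus scaler_sumr -big_split.
by apply: eq_bigr => x _; rewrite /= !linearP.
Qed.
HB.instance Definition _ :=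
  GRing.isLinear.Build C State State *:%R Splus Splus_linear.

Lemma polarization_linear : linear polarization.
Proof.
move=> a u v; rewrite /polarization scaler_sumr -big_split.
by apply: eq_bigr => x _; rewrite /numop !linearP addrACA -scalerDr.
Qed.
HB.instance Definition _ :=
  GRing.isLinear.Build C State State *:%R polarization polarization_linear.

Lemma ann_up_Sminus y psi :
  ann (y, true) (Sminus psi) = Sminus (ann (y, true) psi).
Proof.
rewrite linear_sum; apply: eq_bigr => x _.
rewrite /= ann_cre xpair_eqE andbF sub0r [ann (y, true) (ann _ _)]ann_ann.
by rewrite linearN opprK.
Qed.

Lemma sum_delta (V : zmodType) (I : finType) (y : I) (F : I -> V) :
  \sum_x (if y == x then F x else 0) = F y.
Proof.
by rewrite (bigD1 y) //= eqxx big1 ?addr0 // => x; rewrite eq_sym => /negPf ->.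
Qed.

Lemma ann_dn_Sminus y psi :
  ann (y, false) (Sminus psi) = Sminus (ann (y, false) psi) + ann (y, true) psi.
Proof.
rewrite linear_sum addrC -[ann (y, true) psi](sum_delta y (fun x => ann (x, true) psi)).
rewrite -big_split; apply: eq_bigr => x _.
rewrite /= ann_cre xpair_eqE andbT; congr (_ + _).
by rewrite [ann (y, false) (ann _ _)]ann_ann linearN opprK.
Qed.

Lemma ann_up_Splus y psi :
  ann (y, true) (Splus psi) = Splus (ann (y, true) psi) + ann (y, false) psi.
Proof.
rewrite linear_sum addrC -[ann (y, false) psi](sum_delta y (fun x => ann (x, false) psi)).
rewrite -big_split; apply: eq_bigr => x _.
rewrite /= ann_cre xpair_eqE andbT; congr (_ + _).
by rewrite [ann (y, true) (ann _ _)]ann_ann linearN opprK.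
Qed.

Lemma Splus_cre_dn y psi :
  Splus (cre (y, false) psi) = cre (y, false) (Splus psi) + cre (y, true) psi.
Proof.
rewrite linear_sum addrC -[cre (y, true) psi](sum_delta y (fun x => cre (x, true) psi)).
rewrite -big_split; apply: eq_bigr => x _.
rewrite /= ann_cre xpair_eqE andbT eq_sym linearB /=.
by rewrite [cre (x, true) (cre _ _)]cre_cre opprK; case: eqP => //; rewrite linear0.
Qed.

(** The relation [S^+, S^-] = 2 S^(3), found by commuting [Splus] through each summand of
    [Sminus]. *)
Lemma Splus_Sminus psi :
  Splus (Sminus psi) = Sminus (Splus psi) + polarization psi.
Proof.
rewrite [Sminus psi]/Sminus linear_sum -big_split; apply: eq_bigr => x _ /=.
by rewrite Splus_cre_dn ann_up_Splus linearD /= /numop addrACA subrr addr0.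
Qed.

(** [Sminus] commutes with spin-up annihilators, and its commutator with a spin-down annihilator is
    the spin-up one at the same site. Hence commuting it past [Aann] leaves at most
    [Aann lam b true psi], and past the pair annihilator only the square of an annihilator; both
    vanish. *)
Lemma unfrustrated_Sminus lam psi :
  unfrustrated lam psi -> unfrustrated lam (Sminus psi).
Proof.
case=> hA hD; split=> [b s|x]; last first.
  by rewrite ann_dn_Sminus linearD /= ann_up_Sminus hD linear0 add0r ann_sqr.
have -> : Aann lam b s (Sminus psi) =
    Sminus (Aann lam b s psi) + (if s then 0 else Aann lam b true psi).
  rewrite [X in Sminus X + _]/Aann linearD linearZ (linear_sum Sminus) /=; case: s.
    rewrite addr0 /Aann ann_up_Sminus; congr (_ + _).
    by apply: eq_bigr => x _; rewrite ann_up_Sminus.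
  rewrite /Aann ann_dn_Sminus scalerDr addrACA -big_split; congr (_ + _).
  by apply: eq_bigr => x _; rewrite ann_dn_Sminus.
by rewrite !hA linear0 if_same addr0.
Qed.

Lemma Stot0E psi : Stot 0 psi = 2%:R^-1 *: (Splus psi + Sminus psi).
Proof.
rewrite /Stot /Spin -scaler_sumr /Splus /Sminus -big_split; congr (_ *: _).
apply: eq_bigr => x _; rewrite !big_bool /= /pauli /=.
by rewrite !scale0r !scale1r add0r addr0.
Qed.

Lemma Stot1E psi :
  Stot 1 psi = 2%:R^-1 *: (imagI R *: (Sminus psi - Splus psi)).
Proof.
rewrite /Stot /Spin -scaler_sumr /Splus /Sminus -sumrB.
rewrite [imagI R *: _]scaler_sumr; congr (_ *: _).
apply: eq_bigr => x _; rewrite !big_bool /= /pauli /=.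
by rewrite !scale0r add0r addr0 scalerBr scaleNr addrC.
Qed.

Lemma Stot2E psi : Stot 2%:R psi = 2%:R^-1 *: polarization psi.
Proof.
rewrite /Stot /Spin -scaler_sumr; congr (_ *: _).
apply: eq_bigr => x _; rewrite !big_bool /= /pauli /=.
by rewrite !scale0r !scale1r scaleN1r add0r addr0.
Qed.

Lemma sum_ord3 (V : zmodType) (F : 'I_3 -> V) :
  \sum_a F a = F 0 + F 1 + F 2%:R.
Proof.
rewrite !big_ord_recl big_ord0 addr0 -addrA.
by congr (F _ + (F _ + F _)); apply: val_inj.
Qed.

(** This is the sum of the squares of (P + M)/2 and i(M - P)/2: as i^2 = -1, the terms PP and MM
    cancel and the mixed terms add up. *)
Lemma sum_sqr_ladder (V : lmodType C) (P M : {linear V -> V}) u :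
  2%:R^-1 *: (P (2%:R^-1 *: (P u + M u)) + M (2%:R^-1 *: (P u + M u)))
  + 2%:R^-1 *: (imagI R *: (M (2%:R^-1 *: (imagI R *: (M u - P u)))
                          - P (2%:R^-1 *: (imagI R *: (M u - P u)))))
  = 2%:R^-1 *: (P (M u) + M (P u)).
Proof.
have ii : imagI R * imagI R = -1 by rewrite -sqr_i expr2.
rewrite !linearZ !linearD !linearN /= -!scalerDr !scalerA.
rewrite (_ : imagI R / 2%:R / 2%:R * imagI R = - (2%:R^-1 / 2%:R)); last by field: ii.
rewrite scaleNr -scalerBr -[X in _ = X *: _](mulfK (_ : 2%:R != 0)) ?pnatr_eq0 //.
rewrite mulrAC -[in RHS]scalerA scaler_nat; congr (_ *: _).
rewrite opprK [M (P u) + _]addrC addrACA [- _ + P (P u)]addrC.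
rewrite [M (M u) - _ + _]addrACA -opprD [M (M u) + _]addrC [M (P u) + _]addrC.
by rewrite opprB [LHS]addrC subrKA mulr2n.
Qed.

Lemma Stot2_Splus_Sminus psi : Stot2 psi =
  2%:R^-1 *: (Splus (Sminus psi) + Sminus (Splus psi))
  + 4%:R^-1 *: polarization (polarization psi).
Proof.
rewrite /Stot2 sum_ord3.
rewrite (Stot0E psi) Stot0E (Stot1E psi) Stot1E (Stot2E psi) Stot2E.
congr (_ + _); first exact: (sum_sqr_ladder Splus Sminus).
by rewrite [polarization (_ *: _)]linearZ /= scalerA -invfM -natrM.
Qed.

Lemma casimir_linear (V : lmodType C) (P M Z : {linear V -> V}) (h q : C) :
  linear (fun u => h *: (P (M u) + M (P u)) + q *: Z (Z u)).
Proof.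
move=> a u v.
have lin2 (A B : {linear V -> V}) : A (B (a *: u + v)) = a *: A (B u) + A (B v).
  by rewrite !linearP.
rewrite !lin2 (addrACA (a *: _)) -scalerDr (scalerDr h) (scalerDr q).
by rewrite [a *: (_ + q *: _)]scalerDr !scalerA ![a * _]mulrC addrACA.
Qed.

Lemma Stot2_linear : linear (@Stot2 R d L).
Proof.
move=> a u v; rewrite !Stot2_Splus_Sminus.
exact: (casimir_linear Splus Sminus polarization).
Qed.
HB.instance Definition _ :=
  GRing.isLinear.Build C State State *:%R (@Stot2 R d L) Stot2_linear.

(** * Numbers of up and down electrons *)

Definition spin_count (s : bool) S : nat := \sum_(x : Site) ((x, s) \in S).

Lemma spin_countU s s' (x : Site) S : (x, s) \notin S ->
  spin_count s' ((x, s) |: S) = ((s == s') + spin_count s' S)%N.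
Proof.
move=> nS; rewrite /spin_count (bigD1 x) //= [in RHS](bigD1 x) //= addnA.
congr (_ + _)%N.
  rewrite !inE xpair_eqE eqxx /= eq_sym.
  by case: (eqVneq s s') => [<-|] //=; rewrite (negPf nS).
by apply: eq_bigr => y yx; rewrite !inE xpair_eqE (negPf yx).
Qed.

Lemma spin_countD1 s s' (x : Site) S : (x, s) \in S ->
  spin_count s' S = ((s == s') + spin_count s' (S :\ (x, s)))%N.
Proof. by move=> xS; rewrite -(@spin_countU s s' x) ?setD1K // !inE eqxx. Qed.

Lemma polarizationE psi S : polarization psi S =
  ((spin_count true S)%:R - (spin_count false S)%:R) * psi S.
Proof.
rewrite /polarization /spin_count sum_ffunE !natr_sum -sumrB mulr_suml.
apply: eq_bigr => x _; rewrite ffunE [X in _ + X]ffunE !numopE mulrBl.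
by congr (_ - _); case: (_ \in S); rewrite ?mul1r ?mul0r.
Qed.

Lemma NopE psi S : Nop psi S =
  (spin_count true S + spin_count false S)%:R * psi S.
Proof.
rewrite /Nop /spin_count sum_ffunE natrD !natr_sum -big_split mulr_suml.
apply: eq_bigr => x _; rewrite ffunE !numopE /= mulrDl.
by congr (_ + _); case: (_ \in S); rewrite ?mul1r ?mul0r.
Qed.

(** The joint eigenspace of the up and down electron numbers, expressed through amplitudes because
    both operators are diagonal. *)
Definition supported a b psi : Prop := forall S,
  ~~ ((spin_count true S == a) && (spin_count false S == b)) -> psi S = 0.

Lemma supported_polarization a b psi :
  supported a b psi -> polarization psi = (a%:R - b%:R) *: psi.
Proof.
move=> h; apply/ffunP => S; rewrite polarizationE ffunE.
have [/andP[/eqP-> /eqP->] //|/h ->] :=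
  boolP ((spin_count true S == a) && (spin_count false S == b)).
by rewrite mulr0 scaler0.
Qed.

Lemma supported_in_sector a b psi : supported a b psi -> in_sector (a + b) psi.
Proof.
move=> h; apply/ffunP => S; rewrite NopE ffunE.
have [/andP[/eqP-> /eqP->] //|/h ->] :=
  boolP ((spin_count true S == a) && (spin_count false S == b)).
by rewrite mulr0 scaler0.
Qed.

Lemma supported_cre_up a b x psi :
  supported a b psi -> supported a.+1 b (cre (x, true) psi).
Proof.
move=> h S hS; rewrite ffunE; case: ifP => // xS; rewrite h ?mulr0 //.
by apply: contra hS; rewrite !(spin_countD1 _ xS) !eqE /= ?add0n ?add1n ?eqSS.
Qed.

Lemma supported_Sminus a b psi :
  supported a.+1 b psi -> supported a b.+1 (Sminus psi).
Proof.
move=> h S hS; rewrite sum_ffunE big1 // => x _; rewrite !ffunE.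
case: ifP => // xS; case: ifP => [_|/negbT nx]; rewrite ?mulr0 // h ?mulr0 //.
apply: contra hS; rewrite spin_countU // spin_countU // !(spin_countD1 _ xS).
by rewrite !eqE /= ?add0n ?add1n ?eqSS.
Qed.

Lemma supportedD a b u v :
  supported a b u -> supported a b v -> supported a b (u + v).
Proof. by move=> hu hv S hS; rewrite ffunE hu // hv // addr0. Qed.

Lemma supportedZ a b c u : supported a b u -> supported a b (c *: u).
Proof. by move=> hu S hS; rewrite ffunE hu // scaler0. Qed.

Lemma supported_sum a b (I : finType) (P : pred I) (F : I -> State) :
  (forall i, P i -> supported a b (F i)) -> supported a b (\sum_(i | P i) F i).
Proof.
by move=> hF S hS; rewrite sum_ffunE big1 // => i Pi; apply: hF.
Qed.

(** * The ferromagnetic zero-energy states *)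

(* Creates an up electron in the single-particle zero mode localised at u. *)
Definition flat_cre lam (u : Vtx) psi : State :=
  cre (vsite u, true) psi
  - (rC lam)^-1 *: \sum_(b : Bond | u \in val b) cre (msite b, true) psi.

(** Here [k] counts spin flips; for [k = 0] every localised zero mode holds an up electron. *)
Definition ferro lam k : State :=
  iter k Sminus (foldr (flat_cre lam) (vacuum R d L) (enum {: Vtx})).

Lemma vsite_eq (x u : Vtx) : (vsite x == vsite u) = (x == u).
Proof. by []. Qed.

(** The anticommutator of [Aann] with a creator is the scalar [w]. On the vertex mode it is 1 when
    [s] is up and [u] lies in [b]; among the midpoints only [b' = b] contributes, with [lam], which
    the factor [- lam^-1] turns into a cancelling term. *)
Lemma Aann_flat_cre lam b s u psi : rC lam != 0 ->
  Aann lam b s (flat_cre lam u psi) = - flat_cre lam u (Aann lam b s psi).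
Proof.
move=> lam0; rewrite /flat_cre linearB linearZ /= (linear_sum (Aann lam b s)) /=.
pose w m : C := (\sum_(x in val b) ((vsite x, s) == m)%:R)
  + rC lam * ((msite b, s) == m)%:R.
have hA m : Aann lam b s (cre m psi) = w m *: psi - cre m (Aann lam b s psi).
  rewrite {1}/Aann ann_cre; under eq_bigr do rewrite ann_cre.
  rewrite big_split /= sumrN -linear_sum /= scalerDr scalerN -linearZ addrACA.
  rewrite -opprD -linearD /=; congr (_ - _).
  rewrite /w scalerDl -scalerA scaler_suml; congr (_ + _ *: _).
    by apply: eq_bigr => x _; case: eqP; rewrite ?scale1r ?scale0r.
  by case: eqP; rewrite ?scale1r ?scale0r.
rewrite hA (eq_bigr _ (fun b' _ => hA (msite b', true))) sumrB scalerBr.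
suff -> : w (vsite u, true) *: psi =
    (rC lam)^-1 *: (\sum_(b' : Bond | u \in val b') w (msite b', true) *: psi).
  by rewrite !opprB addrC subrKA.
rewrite -scaler_suml scalerA; congr (_ *: _).
have w1 : w (vsite u, true) = (s && (u \in val b))%:R.
  rewrite /w xpair_eqE /= mulr0 addr0; case: s {hA w} => /=; last first.
    by rewrite big1 // => x _; rewrite xpair_eqE andbF.
  have [ub|ub] := boolP (u \in val b).
    rewrite (bigD1 u) //= eqxx big1 ?addr0 // => x /andP[_ xu].
    by rewrite xpair_eqE andbT vsite_eq (negPf xu).
  rewrite big1 // => x xb; rewrite xpair_eqE andbT vsite_eq; case: eqP => // xu.
  by rewrite xu (negPf ub) in xb.
have w2 b' : w (msite b', true) = rC lam * (s && (b == b'))%:R.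
  rewrite /w big1 ?add0r => [|x _]; last by rewrite xpair_eqE.
  by rewrite xpair_eqE andbC; case: s {hA w w1}.
rewrite w1; under eq_bigr do rewrite w2.
rewrite -mulr_sumr mulKf //; case: s {hA w w1 w2} => /=; last by rewrite big1.
have [ub|ub] := boolP (u \in val b).
  rewrite (bigD1 b) //= eqxx big1 ?addr0 // => x /andP[_ xb].
  by rewrite eq_sym (negPf xb).
by rewrite big1 // => b' ub'; case: eqP => // bb'; rewrite bb' ub' in ub.
Qed.

Lemma ann_dn_flat_cre lam (x : Site) u psi :
  ann (x, false) (flat_cre lam u psi) = - flat_cre lam u (ann (x, false) psi).
Proof.
rewrite /flat_cre linearB linearZ /= (linear_sum (ann (x, false))) /=.
have hA y : ann (x, false) (cre (y, true) psi) = - cre (y, true) (ann (x, false) psi).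
  by rewrite ann_cre xpair_eqE andbF sub0r.
rewrite hA (eq_bigr _ (fun b' _ => hA (msite b'))) sumrN scalerN.
by rewrite opprB opprK addrC.
Qed.

Lemma flat_cre0 lam u : flat_cre lam u 0 = 0.
Proof.
by rewrite /flat_cre linear0 big1 ?scaler0 ?subr0 // => b _; rewrite linear0.
Qed.

Lemma ferroS lam k : ferro lam k.+1 = Sminus (ferro lam k).
Proof. by []. Qed.

Lemma ann_vacuum m : ann m (vacuum R d L) = 0.
Proof.
apply/ffunP => S; rewrite !ffunE; case: ifP => // _.
case: eqP => [/setP/(_ m)|]; rewrite ?mulr0 // !inE eqxx //.
Qed.

Lemma ann_dn_ferro0 lam x : ann (x, false) (ferro lam 0) = 0.
Proof.
rewrite /ferro /=; elim: (enum _) => [|u us IH] /=; first exact: ann_vacuum.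
by rewrite ann_dn_flat_cre IH flat_cre0 oppr0.
Qed.

Lemma unfrustrated_ferro lam k : rC lam != 0 -> unfrustrated lam (ferro lam k).
Proof.
move=> lam0; elim: k => [|k IH]; last exact: unfrustrated_Sminus.
split=> [b s|x]; last by rewrite ann_dn_ferro0 linear0.
rewrite /ferro /=; elim: (enum _) => [|u us IH] /=.
  by rewrite /Aann ann_vacuum big1 ?scaler0 ?addr0 // => x _; rewrite ann_vacuum.
by rewrite Aann_flat_cre // IH flat_cre0 oppr0.
Qed.

Lemma supported_ferro lam k :
  (k <= #|{: Vtx}|)%N -> supported (#|{: Vtx}| - k)%N k (ferro lam k).
Proof.
elim: k => [_|k IH lek]; last first.
  by apply: supported_Sminus; rewrite -subSn // subSS; apply: IH; apply: ltnW.
rewrite subn0 cardE /ferro /=; elim: (enum _) => [|u us IH] /=.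
  move=> S hS; rewrite ffunE; case: eqP => // S0; case/negP: hS.
  by rewrite /spin_count S0 !big1 // => x _; rewrite inE.
apply: supportedD; first exact: supported_cre_up.
rewrite -scaleNr; apply: supportedZ; apply: supported_sum => b _.
exact: supported_cre_up.
Qed.

(** On the configuration with an up electron at every vertex no midpoint is occupied, so each
    [flat_cre] acts through its vertex part alone and contributes only a sign. *)
Lemma ferro0_neq0 lam : ferro lam 0 != 0.
Proof.
pose upset (us : seq Vtx) : {set Mode} :=
  [set m : Mode | if m.1 is inl u then m.2 && (u \in us) else false].
suff h us : uniq us -> foldr (flat_cre lam) (vacuum R d L) us (upset us) != 0.
  apply: contraNneq (h _ (enum_uniq {: Vtx})) => e0.
  by rewrite -[foldr _ _ _]/(ferro lam 0) e0 ffunE.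
elim: us => [_|u us IH /= /andP[uus uniq_us]] /=.
  rewrite ffunE (_ : upset [::] = set0) ?eqxx ?oner_eq0 //.
  by apply/setP => -[[v|b] s]; rewrite !inE //= andbF.
rewrite /flat_cre ffunE [X in _ + X]ffunE [X in _ - X]ffunE sum_ffunE.
rewrite [X in _ *: X]big1 => [|b _]; last by rewrite ffunE inE.
rewrite scaler0 subr0 ffunE inE /= mem_head mulf_neq0 ?jwsign_neq0 //.
rewrite (_ : _ :\ _ = upset us) ?IH //.
apply/setP => -[[v|b] s]; rewrite !inE ?xpair_eqE //= -/(vsite v) vsite_eq.
case: s; rewrite ?andbF // andbT inE; case: (eqVneq v u) => [->|] //=.
by rewrite (negPf uus).
Qed.

(** Write N for the number of vertices. Commuting S^+ past each S^- adds the polarization N - 2j of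
    [ferro lam j], and these sum to (k + 1)(N - k) over j from 0 to k; S^+ kills [ferro lam 0]. *)
Lemma Splus_ferro lam k : (k < #|{: Vtx}|)%N ->
  Splus (ferro lam k.+1) =
  (k.+1%:R * (#|{: Vtx}|%:R - k%:R)) *: ferro lam k.
Proof.
have polE j : (j <= #|{: Vtx}|)%N ->
    polarization (ferro lam j) = (#|{: Vtx}|%:R - j%:R - j%:R) *: ferro lam j.
  by move=> lej; rewrite (supported_polarization (supported_ferro lam lej)) natrB.
elim: k => [|k IH] ltk; rewrite ferroS Splus_Sminus.
  rewrite {1}/Splus big1 => [|x _]; last by rewrite ann_dn_ferro0 linear0.
  by rewrite linear0 add0r (polE _ (leq0n _)) mul1r !subr0.
rewrite IH ?(ltnW ltk) // polE ?(ltnW ltk) // linearZ /=.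
rewrite -ferroS -scalerDl; congr (_ *: _).
by rewrite -!natr1; ring.
Qed.

(** The coefficient in [Splus_ferro] is nonzero below the top value of [k], so a vanishing
    [ferro lam k.+1] would force [ferro lam k] to vanish. *)
Lemma ferro_neq0 lam k : (k <= #|{: Vtx}|)%N -> ferro lam k != 0.
Proof.
elim: k => [_|k IH lek]; first exact: ferro0_neq0.
apply: contraNneq (IH (ltnW lek)) => f0.
have := Splus_ferro lam lek; rewrite f0 linear0 => /esym/eqP.
rewrite scaler_eq0 mulf_eq0 pnatr_eq0 /= subr_eq0 eqr_nat.
by rewrite (gtn_eqF lek).
Qed.

(** S^- S^+ gives k(N - k + 1) and the polarization is N - 2k; in the Casimir operator the
    dependence on [k] cancels. *)
Lemma Stot2_ferro lam k : (k <= #|{: Vtx}|)%N ->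
  Stot2 (ferro lam k) =
  ((#|{: Vtx}|%:R / 2%:R) * (#|{: Vtx}|%:R / 2%:R + 1)) *: ferro lam k.
Proof.
move=> lek; set N := #|{: Vtx}|.
have SmSp : Sminus (Splus (ferro lam k)) =
    (k%:R * (N%:R - k%:R + 1)) *: ferro lam k.
  case: k lek => [|k] lek; last first.
    by rewrite Splus_ferro // linearZ -natr1; congr (_ *: _); rewrite -/N; ring.
  rewrite {1}/Splus big1 => [|x _]; last by rewrite ann_dn_ferro0 linear0.
  by rewrite linear0 mul0r scale0r.
have polE c : polarization (c *: ferro lam k) =
    (N%:R - k%:R - k%:R) *: (c *: ferro lam k).
  rewrite (supported_polarization (supportedZ c (supported_ferro lam lek))).
  by rewrite natrB.
rewrite Stot2_Splus_Sminus Splus_Sminus SmSp.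
have polE1 := polE 1; rewrite !scale1r in polE1.
rewrite polE1 polE -!scalerDl !scalerA -!scalerDl; congr (_ *: _); rewrite -/N.
by field.
Qed.

(** * Relations between amplitudes of a zero-energy state *)

(* Every vertex carries one electron, with spin down exactly on D. *)
Definition spin_config (D : {set Vtx}) : {set Mode} :=
  [set m : Mode | if m.1 is inl v then m.2 == (v \notin D) else false].

Lemma spin_count_site s S :
  spin_count s S = (\sum_(v : Vtx) ((vsite v, s) \in S)
                    + \sum_(b : Bond) ((msite b, s) \in S))%N.
Proof. exact: big_sumType. Qed.

Lemma spin_count_config D : spin_count false (spin_config D) = #|D|.
Proof.
rewrite spin_count_site [X in (_ + X)%N]big1 ?addn0 => [|b _]; last by rewrite inE.
rewrite -sum1_card [RHS]big_mkcond /=; apply: eq_bigr => v _.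
by rewrite inE /=; case: (v \in D).
Qed.

(** The two amplitudes differ by a nonzero sign; vanishing is thus transported without tracking
    signs. *)
Lemma ann_apply_eq0 m psi S : m \notin S -> ann m psi S = 0 <-> psi (m |: S) = 0.
Proof.
move=> mS; rewrite ffunE (negPf mS); split=> [/eqP|->]; last by rewrite mulr0.
by rewrite mulf_eq0 (negPf (jwsign_neq0 _ _)) => /eqP.
Qed.

(** Induction on the number of electrons on midpoints. *)
Lemma unfrustrated_eq0 lam psi : rC lam != 0 -> unfrustrated lam psi ->
  (forall S, (forall b s, (msite b, s) \notin S) -> psi S = 0) -> psi = 0.
Proof.
move=> lam0 [hA _] h0; apply/ffunP => S; rewrite [RHS]ffunE.
pose mid (m : Mode) := if m.1 is inr _ then true else false.
have [n] := ubnP #|[set m in S | mid m]|; elim: n => // n IH in S *.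
move=> /ltnSE le_n.
have [/existsP[b /existsP[s mS]]|nomid] :=
  boolP [exists b : Bond, exists s : bool, (msite b, s) \in S]; last first.
  apply: h0 => b s; apply: contra nomid => mS.
  by apply/existsP; exists b; apply/existsP; exists s.
set m := (msite b, s) in mS *.
have nmS : m \notin S :\ m by rewrite !inE eqxx.
rewrite -(setD1K mS); apply/(ann_apply_eq0 psi nmS).
(* At [S :\ m] the bond equation expresses the amplitude at [S] through those with the electron of
   [m] moved to an end of [b]; these have one midpoint electron fewer. *)
have /ffunP/(_ (S :\ m)) := hA b s.
rewrite /Aann [X in _ = X]ffunE [X in X = _]ffunE sum_ffunE big1 => [|x _].
  by rewrite add0r ffunE => /eqP; rewrite scaler_eq0 (negPf lam0) => /eqP.
have [xS|xS] := boolP ((vsite x, s) \in S :\ m); first by rewrite ffunE xS.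
apply/(ann_apply_eq0 psi xS); apply: IH; apply: leq_trans le_n.
rewrite [X in (_ < X)%N](cardsD1 m) !inE mS /= add1n ltnS.
apply/subset_leq_card/subsetP => m'; rewrite !inE.
by case: eqP => [-> //|_ /= /andP[/andP[-> ->] ->]].
Qed.

(* Only the vanishing of amplitudes is transported, which avoids computing the
   fermionic sign of the exchange. *)
Lemma exchange_eq0 lam psi (v w : Vtx) (b : Bond) (D : {set Vtx}) :
  rC lam != 0 -> unfrustrated lam psi -> val b = [set v; w] ->
  v \in D -> w \notin D -> psi (spin_config D) = 0 ->
  psi (spin_config (w |: D :\ v)) = 0.
Proof.
move=> lam0 [hA hD] bE vD wD hS.
have vw : v != w by apply: contraNneq wD => <-.
have hmid s phi : Aann lam b s phi = 0 -> ann (msite b, s) phi = 0 ->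
    \sum_(x in val b) ann (vsite x, s) phi = 0.
  by rewrite /Aann => + e; rewrite e scaler0 addr0.
have annA s' m phi : Aann lam b s' (ann m phi) = - ann m (Aann lam b s' phi).
  rewrite /Aann ann_ann linearD linearZ (linear_sum (ann m)) opprD scalerN /=.
  by rewrite -sumrN; congr (_ + _); apply: eq_bigr => x _; rewrite ann_ann.
(* With double occupancy excluded at [msite b], the bond operators reduce to the two ends of [b],
   first for spin up and then for spin down. *)
have up0 : ann (msite b, false) (\sum_(x in val b) ann (vsite x, true) psi) = 0.
  rewrite -[LHS]opprK (linear_sum (ann _)) /= -sumrN.
  under eq_bigr do rewrite -ann_ann.
  by rewrite (hmid true) ?oppr0 // annA hA linear0 oppr0.
have := hmid false _ _ up0.
rewrite linear_sum big1 => [/(_ erefl)|x _]; last by rewrite /= annA hA linear0 oppr0.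
(* Excluding double occupancy at the ends leaves two cross terms, which remove opposite spins from
   [v] and [w]; at [S0] they are the two amplitudes to be compared. *)
have dn0 x : ann (vsite x, false) (ann (vsite x, true) psi) = 0.
  by rewrite ann_ann hD oppr0.
rewrite bE !big_setU1 ?inE // !big_set1 !linearD /= !dn0 add0r addr0.
move=> /ffunP/(_ (spin_config D :\ (vsite v, false) :\ (vsite w, true))).
set S0 := _ :\ _; rewrite [X in _ = X]ffunE [X in X = _]ffunE.
have vf : (vsite v, false) \in spin_config D by rewrite inE /= vD.
have wt : (vsite w, true) \in spin_config D :\ (vsite v, false).
  by rewrite !inE xpair_eqE andbF /= wD.
have [wt0 vf0] : (vsite w, true) \notin S0 /\ (vsite v, false) \notin S0.
  by rewrite !inE !xpair_eqE !eqxx /= ?andbF.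
rewrite (_ : ann _ _ S0 = 0) ?add0r; last first.
  apply/ann_apply_eq0 => //; apply/ann_apply_eq0.
    by rewrite in_setU1 negb_or wt0 xpair_eqE andbF.
  by rewrite setUCA !setD1K.
have wf0 : (vsite w, false) \notin S0 by rewrite !inE /= wD !andbF.
have vt0 : (vsite v, true) \notin S0 by rewrite !inE /= vD !andbF.
move/(ann_apply_eq0 _ wf0)/ann_apply_eq0.
rewrite in_setU1 negb_or vt0 xpair_eqE andbF => /(_ isT); congr (psi _ = 0).
apply/setP => -[[x|b'] s]; rewrite !inE ?xpair_eqE //= -/(vsite x) !vsite_eq.
rewrite in_setU1 in_setD1; have [->|xv] := eqVneq x v.
  by rewrite (negPf vw) /=; case: s.
by have [->|xw] := eqVneq x w; rewrite ?(negPf wD) /=; case: s.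
Qed.

(** * Connectivity of the lattice and of spin configurations *)

(** Moves along bonds compose. Lowering one nonzero coordinate at a time links every vertex to the
    origin [o], in both directions. *)
Lemma move_connected (Z : {set Vtx} -> Prop) : (0 < L)%N ->
  (forall (b : Bond) v w (D : {set Vtx}), val b = [set v; w] ->
     v \in D -> w \notin D -> Z D -> Z (w |: D :\ v)) ->
  forall v w (D : {set Vtx}), v \in D -> w \notin D -> Z D -> Z (w |: D :\ v).
Proof.
move=> L0 hb; pose ok v w := forall D : {set Vtx},
  v \in D -> w \notin D -> Z D -> Z (w |: D :\ v).
have trans u v w : ok u v -> ok v w -> ok u w.
  move=> uv vw D uD wD ZD.
  have uw : u != w by apply: contraNneq wD => <-.
  (* If [v] is in [D], it is first moved to [w] and then refilled from [u]; otherwise [u] is moved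
     to [v] and on to [w]. *)
  have [vD|vD] := boolP (v \in D).
    have vw' : v != w by apply: contraNneq wD => <-.
    have [uv'|uv'] := eqVneq u v; first by rewrite uv'; apply: vw.
    have -> : w |: D :\ u = v |: (w |: D :\ v) :\ u.
      apply/setP => x; rewrite !inE; case: (eqVneq x v) => [->|_] //=.
        by rewrite (negPf vw') eq_sym uv' vD.
      by case: (eqVneq x w) => [->|_] //=; rewrite eq_sym uw.
    by apply: uv; [rewrite !inE uv' uD orbT| rewrite !inE eqxx (negPf vw') |apply: vw].
  have [vw'|vw'] := eqVneq v w; first by rewrite -vw'; apply: uv.
  have -> : w |: D :\ u = w |: (v |: D :\ u) :\ v.
    apply/setP => x; rewrite !inE; case: (eqVneq x v) => [->|_] //=.
    by rewrite (negPf vD) andbF.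
  apply: vw; rewrite ?inE ?eqxx //; last exact: uv.
  by rewrite eq_sym (negPf vw') (negPf wD) andbF.
pose o : Vtx := [ffun=> Ordinal L0].
suff h v : ok v o /\ ok o v.
  by move=> v w; apply: (trans v o w); [apply: (h v).1 | apply: (h w).2].
have [n] := ubnP (\sum_i v i)%N; elim: n => // n IH in v *; rewrite ltnS => le_n.
have [/forallP v0|] := boolP [forall i, (v i == 0 :> nat)%N].
  have -> : v = o by apply/ffunP => i; apply: val_inj; rewrite ffunE; apply/eqP/v0.
  (* [ok o o] is vacuous: [o] would lie both inside and outside [D]. *)
  by split=> D oD; rewrite oD.
rewrite negb_forall => /existsP[i vi].
have vi1 : ((v i).-1 < L)%N by apply: leq_ltn_trans (leq_pred _) (ltn_ord _).
pose w : Vtx := [ffun j => if j == i then Ordinal vi1 else v j].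
have wi : w i = Ordinal vi1 by rewrite ffunE eqxx.
have wj j : j != i -> w j = v j by move=> ji; rewrite ffunE (negPf ji).
have bvw : isbond [set v; w].
  apply/existsP; exists v; apply/existsP; exists w; rewrite eqxx andbT.
  apply/existsP; exists i; apply/andP; split.
    by apply/forallP => j; apply/implyP => /wj ->.
  by rewrite wi /= prednK ?lt0n // (modn_small (ltn_ord _)) eqxx orbT.
have [wo ow] : ok w o /\ ok o w.
  apply: IH; apply: leq_trans le_n.
  rewrite (bigD1 i) //= [X in (_ < X)%N](bigD1 i) //= wi /=.
  rewrite (eq_bigr (fun j => v j : nat)) => [|j /wj -> //].
  by rewrite ltn_add2r prednK ?lt0n.
have vw : ok v w by move=> D; apply: (hb (Sub _ bvw)).
have wv : ok w v by move=> D; apply: (hb (Sub _ bvw) w v D (setUC _ _)).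
by split; [apply: trans vw wo | apply: trans ow wv].
Qed.

(** Induction on the size of [D :\: D']: equal cardinality supplies an element of [D'] outside [D]
    to exchange for one of [D] outside [D']. *)
Lemma same_card_connected (Z : {set Vtx} -> Prop) :
  (forall v w (D : {set Vtx}), v \in D -> w \notin D -> Z D -> Z (w |: D :\ v)) ->
  forall D D' : {set Vtx}, #|D| = #|D'| -> Z D -> Z D'.
Proof.
move=> hZ D D'; have [n] := ubnP #|D :\: D'|; elim: n => // n IH in D *.
rewrite ltnS => le_n cDD' ZD.
have [DD'|] := boolP (D \subset D').
  by have /eqP <- : D == D' by rewrite eqEcard DD' cDD' leqnn.
case/subsetPn => v vD vD'.
have : ~~ (D' \subset D).
  apply: contra vD' => D'D.
  by have /eqP -> : D' == D by rewrite eqEcard D'D cDD' leqnn.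
case/subsetPn => w wD' wD.
apply: (IH (w |: D :\ v)); last exact: hZ.
  apply: leq_trans le_n; rewrite [X in (_ < X)%N](cardsD1 v) !inE vD vD' /= add1n ltnS.
  apply/subset_leq_card/subsetP => x; rewrite !inE => /andP[xD'].
  by case/orP => [/eqP xw|/andP[-> ->]]; [rewrite xw wD' in xD' | rewrite xD'].
by rewrite cardsU1 !inE (negPf wD) andbF /= -cDD' [in RHS](cardsD1 v) vD.
Qed.

(** * One amplitude per number of down spins determines the state *)

Lemma in_sectorP N psi :
  in_sector N psi <->
  (forall S, (spin_count true S + spin_count false S != N)%N -> psi S = 0).
Proof.
split=> [hN S cS|h].
  have := congr1 (fun phi : State => phi S) hN; rewrite NopE ffunE => /eqP.
  rewrite -subr_eq0 -mulrBl mulf_eq0 subr_eq0 eqr_nat (negPf cS).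
  by move/eqP.
apply/ffunP => S; rewrite NopE ffunE.
have [<- //|/h ->] := eqVneq (spin_count true S + spin_count false S)%N N.
by rewrite mulr0 scaler0.
Qed.

Lemma single_occupancy S :
  (forall b s, (msite b, s) \notin S) ->
  (forall v, (vsite v, true) \in S -> (vsite v, false) \notin S) ->
  (spin_count true S + spin_count false S = #|{: Vtx}|)%N ->
  S = spin_config [set v | (vsite v, false) \in S].
Proof.
move=> hm h2; rewrite !spin_count_site.
have hm0 s : (\sum_(b : Bond) ((msite b, s) \in S))%N = 0%N.
  by rewrite big1 // => b _; rewrite (negPf (hm b s)).
rewrite !hm0 !addn0.
rewrite -big_split /= -sum1_card => /eqP.
(* Each vertex carries at most one electron and the total is the number of vertices, so the equality
   case of the sum forces exactly one at each. *)
rewrite (leqif_sum (C := fun v => ((vsite v, true) \in S) (+) ((vsite v, false) \in S)));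
  last first.
  move=> v _; have := h2 v.
  by case: (_ \in S) => /=; [move=> /(_ isT)/negPf -> | case: (_ \in S)]; split.
move/forallP => hv; apply/setP => -[[v|b] s]; rewrite !inE /=; last exact: negPf (hm b s).
rewrite -[inl v]/(vsite v).
rewrite inE; have := hv v.
by case: s; case: ((vsite v, true) \in S); case: ((vsite v, false) \in S).
Qed.

Lemma ground_eq0 lam psi : (0 < L)%N -> rC lam != 0 -> unfrustrated lam psi ->
  in_sector #|{: Vtx}| psi ->
  (forall k, (k <= #|{: Vtx}|)%N ->
     exists2 D : {set Vtx}, #|D| = k & psi (spin_config D) = 0) ->
  psi = 0.
Proof.
move=> L0 lam0 hu /in_sectorP hN hk; apply: (unfrustrated_eq0 lam0 hu) => S hm.
have [cS|/hN //] := eqVneq (spin_count true S + spin_count false S)%N #|{: Vtx}|.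
have [|] := boolP [forall v : Vtx,
  ((vsite v, true) \in S) ==> ((vsite v, false) \notin S)].
  move=> /forallP h2.
  rewrite (single_occupancy hm _ cS) => [|v]; last exact/implyP.
  set D := [set v | _]; have [D' cD' ZD'] := hk _ (max_card D).
  apply: (same_card_connected (Z := fun D => psi (spin_config D) = 0) _ cD' ZD').
  apply: move_connected => // b v w D0 bE; exact: exchange_eq0 lam0 hu bE.
rewrite negb_forall => /existsP[v]; rewrite negb_imply negbK => /andP[vt vf].
(* Here [v] is doubly occupied, and up to sign the amplitude is one of the vanishing
   pair-annihilated state. *)
have := hu.2 (vsite v) => /ffunP/(_ (S :\ (vsite v, false) :\ (vsite v, true))).
rewrite [RHS]ffunE => /ann_apply_eq0; rewrite !inE eqxx => /(_ isT).
rewrite setD1K ?inE ?vt ?up_neq_dn // => /ann_apply_eq0; rewrite !inE eqxx => /(_ isT).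
by rewrite setD1K.
Qed.

(** * A basis of the ground state space *)

Definition first_sites k : {set Vtx} := [set x in take k (enum {: Vtx})].

Lemma card_first_sites k : (k <= #|{: Vtx}|)%N -> #|first_sites k| = k.
Proof.
move=> lek; rewrite /first_sites cardsE (card_uniqP _) ?take_uniq ?enum_uniq //.
by rewrite size_takel // -cardE.
Qed.

Lemma ferro_config lam j (D : {set Vtx}) : (j <= #|{: Vtx}|)%N -> #|D| != j ->
  ferro lam j (spin_config D) = 0.
Proof.
move=> lej cD; apply: (supported_ferro lam lej).
by rewrite spin_count_config negb_and cD orbT.
Qed.

Lemma in_sector_ferro lam k : (k <= #|{: Vtx}|)%N ->
  in_sector #|{: Vtx}| (ferro lam k).
Proof.
by move=> lek; have := supported_in_sector (supported_ferro lam lek); rewrite subnK.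
Qed.

(** At representatives with another number of down spins [ferro lam k] vanishes; if it vanished here
    too, [ground_eq0] would make it zero. *)
Lemma ferro_config_neq0 lam k : (0 < L)%N -> rC lam != 0 -> (k <= #|{: Vtx}|)%N ->
  ferro lam k (spin_config (first_sites k)) != 0.
Proof.
move=> L0 lam0 lek; apply: contraNneq (ferro_neq0 lam lek) => f0; apply/eqP.
apply: (ground_eq0 L0 lam0 (unfrustrated_ferro k lam0)); first exact: in_sector_ferro.
move=> j lej; exists (first_sites j); first exact: card_first_sites.
have [<- //|jk] := eqVneq k j; apply: ferro_config => //.
by rewrite card_first_sites // eq_sym.
Qed.

Lemma in_sector_comb N (I : finType) (c : I -> C) (F : I -> State) :
  (forall i, in_sector N (F i)) -> in_sector N (\sum_i c i *: F i).
Proof.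
move=> hF; apply/in_sectorP => S hS; rewrite sum_ffunE big1 // => i _.
by rewrite ffunE ((in_sectorP _ _).1 (hF i)) // scaler0.
Qed.

Definition ferro_basis lam : #|{: Vtx}|.+1.-tuple State :=
  [tuple ferro lam k | k < #|{: Vtx}|.+1].

Lemma nth_ferro_basis lam (k : 'I_#|{: Vtx}|.+1) :
  (ferro_basis lam)`_k = ferro lam k.
Proof. by rewrite -tnth_nth tnth_mktuple. Qed.

(** Evaluation at the representatives is diagonal on the [ferro] states, so it isolates one
    coefficient. *)
Lemma comb_ferro_config lam (c : 'I_#|{: Vtx}|.+1 -> C) (k : 'I_#|{: Vtx}|.+1) :
  (\sum_j c j *: ferro lam j) (spin_config (first_sites k)) =
  c k * ferro lam k (spin_config (first_sites k)).
Proof.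
rewrite sum_ffunE (bigD1 k) //= big1 ?addr0 => [|j jk]; first by rewrite ffunE.
rewrite ffunE ferro_config ?scaler0 // -1?ltnS // card_first_sites -1?ltnS //.
by rewrite eq_sym.
Qed.

Lemma free_ferro_basis lam : (0 < L)%N -> rC lam != 0 -> free (ferro_basis lam).
Proof.
move=> L0 lam0; apply/freeP => c hc k; apply/eqP.
have hc' : \sum_j c j *: ferro lam j = 0.
  by rewrite -[RHS]hc; apply: eq_bigr => j _; rewrite nth_ferro_basis.
have := comb_ferro_config lam c k; rewrite hc' ffunE => /esym/eqP.
by rewrite mulf_eq0 (negPf (ferro_config_neq0 _ _ _)) ?orbF // -ltnS.
Qed.

Lemma span_ferro_basis lam psi : (0 < L)%N -> rC lam != 0 ->
  (in_sector #|{: Vtx}| psi /\ unfrustrated lam psi) <->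
  psi \in <<ferro_basis lam>>%VS.
Proof.
move=> L0 lam0.
have lek (k : 'I_#|{: Vtx}|.+1) : (k <= #|{: Vtx}|)%N by rewrite -ltnS.
split=> [[hN hu]|/coord_span ->]; last first.
  under eq_bigr do rewrite nth_ferro_basis.
  by split; [apply: in_sector_comb => k; exact: in_sector_ferro
            | apply: unfrustrated_comb => k; exact: unfrustrated_ferro].
(* Coefficients chosen so that [psi] and the combination agree at every representative; [ground_eq0]
   then kills their difference. *)
pose c (k : 'I_#|{: Vtx}|.+1) : C :=
  psi (spin_config (first_sites k)) / ferro lam k (spin_config (first_sites k)).
have -> : psi = \sum_k c k *: ferro lam k.
  apply/eqP; rewrite -subr_eq0; apply/eqP.
  set phi := \sum_k _.
  have hphi : in_sector #|{: Vtx}| phi /\ unfrustrated lam phi.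
    by split; [apply: in_sector_comb => k; exact: in_sector_ferro
              | apply: unfrustrated_comb => k; exact: unfrustrated_ferro].
  (* Writing the difference as a linear combination indexed by [bool] brings it under the two
     closure lemmas for sums. *)
  have hB : psi - phi = \sum_(b : bool) (-1) ^+ b *: (if b then phi else psi).
    by rewrite big_bool /= expr1 expr0 scaleN1r scale1r addrC.
  apply: (@ground_eq0 lam) => //.
  - by rewrite hB; apply: unfrustrated_comb => -[]; case: hphi.
  - by rewrite hB; apply: in_sector_comb => -[]; case: hphi.
  move=> k lek'; exists (first_sites k); first exact: card_first_sites.
  rewrite ffunE [X in _ + X]ffunE /phi.
  have := comb_ferro_config lam c (Ordinal (lek' : k < _.+1)%N) => /= ->.
  by rewrite /c /= divfK ?subrr ?ferro_config_neq0.
apply: memv_suml => k _; apply: memvZ; rewrite -nth_ferro_basis.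
by apply: memv_span; apply: mem_nth; rewrite size_tuple.
Qed.

Lemma card_Vtx : #|{: Vtx}| = (L ^ d)%N.
Proof. by rewrite card_ffun !card_ord. Qed.

End FlatBand.

(** * Ground energy, total spin and degeneracy *)

Theorem theorem2p3 (R : realType) (d L : nat) (t lam U U' : R) :
  (1 <= d)%N -> (4 <= L)%N -> ~~ odd L ->
  0 < t -> 0 < lam -> 0 < U -> 0 < U' ->
  exists E0 : R[i],
    is_ground_energy (@Ham R d L t lam U U') (L ^ d) E0 /\
    (* every ground state has total spin S_tot = N_e/2 *)
    (forall psi : State R d L,
        in_ground_space (@Ham R d L t lam U U') (L ^ d) E0 psi ->
        Stot2 psi = (((L ^ d)%:R / 2%:R) * ((L ^ d)%:R / 2%:R + 1)) *: psi) /\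
    (* the ground-state space has dimension N_e + 1 = 2 S_tot + 1 *)
    (exists B : seq (State R d L),
        size B = (L ^ d).+1 /\ free B /\
        (forall psi : State R d L,
            in_ground_space (@Ham R d L t lam U U') (L ^ d) E0 psi <->
            psi \in <<B>>%VS)).
Proof.
move=> _ L4 _ t0 lam0 U0 U'0; rewrite -card_Vtx.
have L0 : (0 < L)%N by apply: leq_trans L4.
have l0 := rC_neq0 lam0.
have groundP psi : in_ground_space (@Ham R d L t lam U U') #|{: Vtx d L}| 0 psi <->
    psi \in <<ferro_basis d L lam>>%VS.
  rewrite -span_ferro_basis // /in_ground_space scale0r.
  by split=> -[hN h]; split=> //; apply/(Ham_eq0 lam t0 U0 U'0).
exists 0; split.
  split=> [|E psi psi0 _ HE]; last exact: (Ham_eigenvalue_ge0 t0 U0 U'0 psi0 HE).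
  exists (ferro d L lam 0); split; first exact: ferro0_neq0.
  split; first exact: in_sector_ferro.
  by rewrite scale0r; apply/(Ham_eq0 lam t0 U0 U'0); exact: unfrustrated_ferro.
split=> [psi /groundP/coord_span ->|]; last first.
  exists (ferro_basis d L lam); rewrite size_tuple; split=> //; split=> //.
  exact: free_ferro_basis.
under eq_bigr do rewrite nth_ferro_basis.
(* The eigenvalue in [Stot2_ferro] is the same for all [k], so it passes to linear combinations. *)
rewrite linear_sum scaler_sumr; apply: eq_bigr => k _ /=; rewrite linearZ /=.
have lek : (k <= #|{: Vtx d L}|)%N by rewrite -ltnS ltn_ord.
by rewrite (Stot2_ferro lam lek) [LHS]scalerA [RHS]scalerA mulrC.
Qed.
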